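(* For every $n\ge 0$, $$\mathsf{Pop}(\mathrm{Tam}_{n+1};q)=\sum_{k=0}^{\lfloor n/2\rfloor}\frac{1}{k+1}\binom{2k}{k}\binom{n}{2k}q^{\,n-k}.$$ In particular, setting $q=1$, for every $n\ge 1$ the image $\mathsf{Pop}_{\mathrm{Tam}_n}(\mathrm{Tam}_n)$ has exactly $M_{n-1}$ elements, where $M_m=\sum_{k\ge 0}\binom{m}{2k}C_k$ is the $m$-th Motzkin number ($C_k$ the Catalan numbers).
   Context: For a finite lattice $L$, $\mathsf{Pop}_L(x)=\bigwedge(\{y\in L: y\lessdot x\}\cup\{x\})$, where $y\lessdot x$ means $x$ covers $y$. For $b\in L$, $\mathscr{U}_L(b)$ is the set of elements of $L$ that cover $b$, and $\mathsf{Pop}(L;q)=\sum_{b\in\mathsf{Pop}_L(L)}q^{|\mathscr{U}_L(b)|}$. $\mathrm{Tam}_n$ is the $n$-th Tamari lattice (on Dyck paths of semilength $n$); equivalently it is isomorphic to the lattice $\mathrm{Av}_n(312)$ of $312$-avoiding permutations of $[n]$ under the right weak order (in which $y\lessdot x$ iff $y$ is obtained from $x$ by swapping two adjacent entries $x_i>x_{i+1}$). *)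

(* Defs.v *)
From mathcomp Require Import all_boot all_order all_algebra.
Set Implicit Arguments. Unset Strict Implicit. Unset Printing Implicit Defensive.

Section FinPoset.
Variables (T : finType) (le : rel T).

Definition plt (x y : T) : bool := (x != y) && le x y.

Definition covb (y x : T) : bool :=
  plt y x && [forall z : T, ~~ (plt y z && plt z x)].

Definition is_glb (S : {set T}) (m : T) : bool :=
  [forall s in S, le m s] &&
  [forall l : T, [forall s in S, le l s] ==> le l m].

Definition pop_image : {set T} :=
  [set b | [exists x : T, is_glb (x |: [set y | covb y x]) b]].

Definition upcovers (b : T) : {set T} := [set z | covb b z].

Definition pop_poly : {poly int} :=
  \sum_(b in pop_image) 'X^(#|upcovers b|).
End FinPoset.

(* true = up step U, false = down step D *)
Definition balanced (s : seq bool) : bool :=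
  all (fun i => count_mem false (take i s) <= count_mem true (take i s))
      (iota 0 (size s).+1)
  && (count_mem true s == count_mem false s).

Definition dyck_path (n : nat) := {t : (n.*2).-tuple bool | balanced t}.

(* Tamari rotation: s = A ++ D :: U :: B ++ D :: C with B a Dyck word
   (so U B D is the excursion starting at that U) becomes
   t = A ++ U :: B ++ D :: D :: C, with |A| = i, |B| = k. *)
Definition rotate_at (s : seq bool) (i k : nat) : seq bool :=
  take i s ++ [:: true] ++ take k (drop i.+2 s) ++ [:: false; false]
    ++ drop (i + k).+3 s.

Definition rot_ok (s : seq bool) (i k : nat) : bool :=
  [&& (i + k).+2 < size s, nth true s i == false, nth false s i.+1 == true,
      nth true s (i + k).+2 == false & balanced (take k (drop i.+2 s))].

Definition rotb (s t : seq bool) : bool :=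
  has (fun i => has (fun k => rot_ok s i k && (t == rotate_at s i k))
                    (iota 0 (size s))) (iota 0 (size s)).

Definition tam_rot (n : nat) : rel (dyck_path n) :=
  fun x y => rotb (val (val x)) (val (val y)).

Definition tam_le (n : nat) : rel (dyck_path n) := connect (@tam_rot n).

Definition catalan (k : nat) : nat := 'C(k.*2, k) %/ k.+1.
Definition motzkin (m : nat) : nat := \sum_(k < m.+1) 'C(m, k.*2) * catalan k.

(* Main.v *)
(* Number the up-steps of a Dyck path and send the i-th one to the index of the
   last up-step of its excursion. A Tamari rotation raises a single entry of
   this vector, and the Tamari order becomes the componentwise order. Hence
   meets are componentwise minima: Pop detaches the last child of every inner
   vertex of the forest of excursions, and the elements covering b correspond
   to the leaves of b other than the last one. A path is in the image of Pop iff
   its inner excursions have distinct ends, none of them at the very end, that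
   is iff it is P U D where P has no three consecutive D's. Replacing in P the
   factors U, U D and U D D that start at each U by an up, a flat and a down
   step gives a Motzkin path with one up-step per inner excursion; such paths with k
   up-steps are counted by the ballot numbers. *)
Require Import Defs.
From mathcomp Require Import all_boot all_order all_algebra.
From mathcomp Require Import zify.
Import GRing.Theory.

(** * Binary trees and bracket vectors *)

(* [Node l r] stands for the Dyck word [l U r D]. *)
Inductive btree := Leaf | Node of btree & btree.

Fixpoint bsize t := if t is Node l r then (bsize l + bsize r).+1 else 0.

(* The index of the last up-step in the excursion of the [i]-th up-step, both
   numbered from 0; junk for [i >= bsize t]. *)
Fixpoint fend t i :=
  if t is Node l r then
    if i < bsize l then fend l i
    else if i == bsize l then bsize l + bsize r
    else (bsize l).+1 + fend r (i - (bsize l).+1)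
  else 0.

(** A form of the bracket vectors of Huang and Tamari; the second condition makes the intervals from
    [i] to [f i] a laminar family. *)
Definition bracketing n (f : nat -> nat) :=
  (forall i, i < n -> i <= f i < n) /\
  (forall i j, i < n -> i <= j <= f i -> f j <= f i).

Lemma fend_bracketing t : bracketing (bsize t) (fend t).
Proof.
elim: t => [|l [IHl1 IHl2] r [IHr1 IHr2]]; first by split.
split=> [i|i j] /= lti.
  case: ltngtP => [il|il|->]; last by lia.
    by have := IHl1 _ il; lia.
  by have := IHr1 (i - (bsize l).+1); lia.
case: (ltngtP i (bsize l)) => il.
- have := IHl1 _ il => b1 /andP[ij jf].
  have jl : j < bsize l by lia.
  by rewrite jl; apply: IHl2 => //; rewrite ij.
- move=> /andP[ij jf].
  have lj : bsize l < j by lia.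
  rewrite ltnNge (ltnW lj) /= gtn_eqF // leq_add2l.
  by apply: IHr2; lia.
- move=> /andP[ij jf]; subst i.
  case: ltngtP ij => // lj _.
  by have := IHr1 (j - (bsize l).+1); lia.
Qed.

Lemma fend_ge t i : i < bsize t -> i <= fend t i.
Proof. by move/(fend_bracketing t).1 => /andP[]. Qed.

Lemma fend_lt t i : i < bsize t -> fend t i < bsize t.
Proof. by move/(fend_bracketing t).1 => /andP[]. Qed.

(** The root index [bsize l] is the least one whose excursion ends at the last index, so the vector
    determines where the tree splits. *)
Lemma fend_inj t t' : bsize t = bsize t' ->
  (forall i, i < bsize t -> fend t i = fend t' i) -> t = t'.
Proof.
elim: t t' => [|l IHl r IHr] [|l' r'] //= [eqs] eqf.
have eql : bsize l = bsize l'.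
  case: (ltngtP (bsize l) (bsize l')) => // ltl.
    have := eqf (bsize l); rewrite ltnn eqxx ltl.
    by have := fend_lt _ _ ltl; lia.
  have := eqf (bsize l'); rewrite ltnn eqxx ltl.
  by have := fend_lt _ _ ltl; lia.
have -> : l = l'.
  apply: IHl => // i il; have := eqf i; rewrite -eql il; apply.
  by lia.
have -> // : r = r'.
apply: IHr => [|i ir]; first by lia.
have := eqf ((bsize l).+1 + i); rewrite -eql.
have -> : ((bsize l).+1 + i < bsize l) = false by lia.
have -> : ((bsize l).+1 + i == bsize l) = false by lia.
by rewrite addKn => /(_ ltac:(lia)) /addnI.
Qed.

Lemma bracketing_fend n f : bracketing n f ->
  exists2 t, bsize t = n & forall i, i < n -> fend t i = f i.
Proof.
elim/ltn_ind: n f => -[|n] IH f [f1 f2]; first by exists Leaf.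
have fn : f n == n by have := f1 n; lia.
have exk : exists k, f k == n by exists n.
case: (ex_minnP exk) => k /eqP fk mink.
have kn : k <= n := mink _ fn.
(* The root will be [k]. If some [i < k] had [f i >= k], nesting would give [f i >= f k = n],
   against the minimality of [k]; so [f] restricts to both sides of [k]. *)
have fltk i : i < k -> f i < k.
  move=> ik; rewrite ltnNge; apply/negP => kf.
  have := f2 i k; have := mink i; have := f1 i.
  by case: eqP; lia.
have [||l sl fl] := IH k _ f; first by [].
  split=> [i ik|i j ik]; last by apply: f2; lia.
  by have := f1 i; have := fltk i; lia.
have [||r sr fr] := IH (n - k) _ (fun i => f (k.+1 + i) - k.+1); first by lia.
  split=> [i ik|i j ik ij].
    by have := f1 (k.+1 + i); lia.
  by have := f2 (k.+1 + i) (k.+1 + j); have := f1 (k.+1 + i); lia.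
exists (Node l r) => [|i ltin] /=; first by lia.
rewrite sl sr; case: ltngtP => [|ki|->]; [exact: fl| |lia].
by rewrite fr; [rewrite (_ : k.+1 + (i - k.+1) = i); have := f1 i; lia|lia].
Qed.

(** On words, the root case turns [a U b D U c D] into [a U b U c D D]: tree rotation is Tamari
    rotation. *)
Inductive brot : btree -> btree -> Prop :=
| brot_root a b c : brot (Node (Node a b) c) (Node a (Node b c))
| brot_left l l' r : brot l l' -> brot (Node l r) (Node l' r)
| brot_right l r r' : brot r r' -> brot (Node l r) (Node l r').

Lemma brot_bsize t t' : brot t t' -> bsize t = bsize t'.
Proof. by elim=> //= *; lia. Qed.

Lemma brot_fend t t' : brot t t' ->
  forall i, i < bsize t -> fend t i <= fend t' i.
Proof.
elim=> {t t'} [a b c|l l' r rl IH|l r r' rr IH] i /= lti.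
- case: (ltngtP i (bsize a)) => [ia|ai|->].
  + by rewrite (_ : i < _ = true) //; lia.
  + rewrite (_ : (i < (bsize a + bsize b).+1) =
      (i - (bsize a).+1 < bsize b)); last by lia.
    rewrite (_ : (i == (bsize a + bsize b).+1) =
      (i - (bsize a).+1 == bsize b)); last by lia.
    case: ltngtP => ib; try lia.
    by rewrite (_ : i - (bsize a + bsize b).+2 =
      i - (bsize a).+1 - (bsize b).+1); lia.
  + by rewrite (_ : bsize a < _ = true); lia.
- rewrite -(brot_bsize _ _ rl); case: ltnP => // il; exact: IH.
- rewrite -(brot_bsize _ _ rr).
  case: ltngtP => // il; rewrite leq_add2l; apply: IH; lia.
Qed.

Lemma fend_left l r i : i < bsize l -> fend (Node l r) i = fend l i.
Proof. by move=> /= ->. Qed.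

Lemma fend_mid l r : fend (Node l r) (bsize l) = bsize l + bsize r.
Proof. by rewrite /= ltnn eqxx. Qed.

Lemma fend_right l r i : bsize l < i ->
  fend (Node l r) i = (bsize l).+1 + fend r (i - (bsize l).+1).
Proof. by move=> /=; case: ltngtP. Qed.

(** The excursions ending at [m] are nested, and the outermost, which starts at the least [k],
    closes right before up-step [m.+1]. Rotating at that valley absorbs the excursion of [m.+1] into
    that of [k]. *)
Lemma brot_raise t k m : m.+1 < bsize t -> k < bsize t -> fend t k = m ->
    (forall j, j < k -> fend t j != m) ->
  exists2 t', brot t t' & forall i, i < bsize t ->
    fend t' i = if i == k then fend t m.+1 else fend t i.
Proof.
elim: t k m => [|l IHl r IHr] k m // ltm ltk.
have sN : bsize (Node l r) = (bsize l + bsize r).+1 by [].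
case: (ltngtP k (bsize l)) => [kl|lk|->]; last by rewrite fend_mid; lia.
- rewrite fend_left // => fk mink.
  have ml := fend_lt _ _ kl; rewrite fk in ml.
  case: (ltngtP m.+1 (bsize l)) => [m1|m1|m1]; [|lia|].
  + have [j jk|t' rt ft] := IHl k m m1 kl fk.
      by have := mink j jk; rewrite fend_left ?(ltn_trans jk kl).
    have st' := brot_bsize _ _ rt.
    exists (Node t' r) => [|i lti]; first exact: brot_left.
    rewrite [fend _ m.+1]fend_left //; case: (ltngtP i (bsize l)) => il.
    * by rewrite !fend_left // -?st' // ft.
    * rewrite (_ : (i == k) = false); last by lia.
      by rewrite !fend_right -?st'.
    * rewrite (_ : (i == k) = false); last by lia.
      by rewrite il {1}st' !fend_mid -st'.
  (* Here [m.+1] is the root, so the rotation is at the root; minimality of [k] makes it the root of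
     the left subtree. *)
  + case: l sN kl fk mink ml m1 {IHl} ltm ltk => [|a b] //.
    move=> sN kl fk mink ml m1 ltm ltk.
    have sab : bsize (Node a b) = (bsize a + bsize b).+1 by [].
    exists (Node a (Node b r)) => [|i lti]; first exact: brot_root.
    have ek : k = bsize a.
      case: (ltngtP k (bsize a)) => // ka.
        by move: fk; rewrite fend_left //; have := fend_lt _ _ ka; lia.
      by have := mink _ ka; rewrite fend_left ?sab ?fend_mid; lia.
    rewrite m1 fend_mid ek sab; case: (ltngtP i (bsize a)) => [ia|ai|->].
    * by rewrite !fend_left // sab; lia.
    * rewrite fend_right //.
      have [ib|ib|ib] := ltngtP (i - (bsize a).+1) (bsize b).
      - rewrite fend_left // fend_left; last by rewrite sab; lia.
        by rewrite fend_right.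
      - rewrite !fend_right // sab; last by lia.
        rewrite (_ : i - (bsize a).+1 - (bsize b).+1 =
                      i - (bsize a + bsize b).+2); lia.
      - rewrite ib fend_mid (_ : i = bsize (Node a b)) ?fend_mid; lia.
    * by rewrite fend_mid /=; lia.
- rewrite fend_right // => fk mink.
  have [|||j jk|t' rt ft] := IHr (k - (bsize l).+1) (m - (bsize l).+1).
  + by lia.
  + by lia.
  + by lia.
  + have := mink (j + (bsize l).+1); rewrite fend_right; last by lia.
    rewrite addnK; lia.
  have st' := brot_bsize _ _ rt.
  exists (Node l t') => [|i lti]; first exact: brot_right.
  case: (ltngtP i (bsize l)) => il.
  + rewrite (_ : (i == k) = false); last by lia.
    by rewrite !fend_left.
  + rewrite !fend_right //; last by lia.
    rewrite ft; last by lia.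
    rewrite (_ : (i - (bsize l).+1 == k - (bsize l).+1) = (i == k)); last by lia.
    case: (_ =P k) => // _; congr (_ + fend _ _); lia.
  + rewrite (_ : (i == k) = false); last by lia.
    by rewrite il !fend_mid -st'.
Qed.

(** * Dyck words and rotations *)

(** A recursive counterpart of [balanced], with arbitrary starting height [h] so that induction on
    the word goes through. *)
Fixpoint dyckw (h : nat) s :=
  match s with
  | [::] => h == 0
  | true :: s' => dyckw h.+1 s'
  | false :: s' => (0 < h) && dyckw h.-1 s'
  end.

Lemma balancedE s : balanced s = dyckw 0 s.
Proof.
have dyckP : forall h : nat, dyckw h s <->
    (forall i, i <= size s ->
       count_mem false (take i s) <= h + count_mem true (take i s)) /\
    h + count_mem true s = count_mem false s.
  elim: s => [|[] s IH] h /=.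
  - split=> [/eqP->|[_ ]]; last by lia.
    by split=> // i; rewrite leqn0 => /eqP->.
  - rewrite IH add0n add1n addnS -addSn.
    split=> -[le_s eq_s]; split=> //.
      by case=> [|i] //= lti; rewrite add0n add1n addnS -addSn; apply: le_s.
    move=> i lti; have := le_s i.+1 lti.
    by rewrite /= add0n add1n addnS -addSn.
  - case: h => [|h] /=.
      by split=> // -[/(_ 1 isT)] /=; rewrite take0.
    rewrite IH add0n add1n addSn.
    split=> -[le_s eq_s]; split; try by [rewrite eq_s|case: eq_s].
      case=> [|i] //= lti; rewrite add0n add1n addSn ltnS; exact: le_s.
    move=> i lti; have := le_s i.+1 lti.
    by rewrite /= add0n add1n addSn ltnS.
apply/idP/idP => [/andP[/allP le_s /eqP eq_s]|/dyckP[le_s eq_s]].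
  apply/dyckP; split=> // i lti; apply: le_s.
  by rewrite mem_iota.
apply/andP; split; last by apply/eqP.
by apply/allP => i; rewrite mem_iota ltnS => /le_s.
Qed.

Fixpoint bword t :=
  if t is Node l r then bword l ++ true :: bword r ++ [:: false] else [::].

(* Left-to-right parser: the tree of the current level and the stack of the
   trees preceding the pending up-steps. *)
Definition pstate := (btree * seq btree)%type.

Definition pstep (st : pstate) (b : bool) : pstate :=
  if b then (Leaf, st.1 :: st.2)
  else if st.2 is l :: stk then (Node l st.1, stk) else st.

Definition word_tree s := (foldl pstep (Leaf, [::]) s).1.

Lemma foldl_bword t stk : foldl pstep (Leaf, stk) (bword t) = (t, stk).
Proof.
elim: t stk => [|l IHl r IHr] stk //=.
by rewrite foldl_cat IHl /= foldl_cat IHr.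
Qed.

Lemma bwordK : cancel bword word_tree.
Proof. by move=> t; rewrite /word_tree foldl_bword. Qed.

Lemma dyckw_bword t h s : dyckw h (bword t ++ s) = dyckw h s.
Proof.
elim: t h s => [|l IHl r IHr] h s //=.
by rewrite -?catA IHl /= -catA IHr.
Qed.

Lemma bword_dyck t : dyckw 0 (bword t).
Proof. by rewrite -[bword t]cats0 dyckw_bword. Qed.

(** Parser invariant: the input read so far is [stack_word st.2 ++ bword st.1], and the height
    reached is the size of the stack. *)
Fixpoint stack_word stk :=
  if stk is l :: stk' then stack_word stk' ++ bword l ++ [:: true] else [::].

Lemma word_treeK s : dyckw 0 s -> bword (word_tree s) = s.
Proof.
rewrite /word_tree; set st : pstate := (Leaf, [::]).
rewrite -[s in RHS]/(stack_word st.2 ++ bword st.1 ++ s).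
rewrite -[0]/(size st.2); elim: s st => [|[] s IH] [c stk] /=.
- by case: stk => // _; rewrite cats0.
- by move=> ds; rewrite IH //= -?catA.
- by case: stk => [|l stk] //= ds; rewrite IH //= -?catA /= -?catA.
Qed.

Lemma size_bword t : size (bword t) = (bsize t).*2.
Proof.
by elim: t => //= l IHl r IHr; rewrite size_cat /= size_cat /= IHl IHr; lia.
Qed.

Lemma dyckw_foldl st s s' : dyckw (size st.2) (s ++ s') ->
  dyckw (size (foldl pstep st s).2) s'.
Proof.
elim: s st => [|[] s IH] [c stk] //= ds; first by apply: IH.
by case: stk ds => [|l stk] //= ds; apply: IH.
Qed.

(** Parser states that differ by one rotation. Reading a letter only moves trees between stack and
    current level or places them under a [Node], which keeps this relation. *)
Inductive prot : pstate -> pstate -> Prop :=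
| prot_cur c c' stk : brot c c' -> prot (c, stk) (c', stk)
| prot_stack c s1 s2 x x' : brot x x' ->
    prot (c, s1 ++ x :: s2) (c, s1 ++ x' :: s2).

Lemma prot_foldl st st' s :
  prot st st' -> prot (foldl pstep st s) (foldl pstep st' s).
Proof.
elim: s st st' => [|b s IH] st st' //= rst; apply: IH.
case: rst => [c c' stk rc|c s1 s2 x x' rx]; case: b => /=.
- exact: (prot_stack Leaf [::]).
- by case: stk => [|l stk]; constructor=> //; constructor.
- by apply: (prot_stack Leaf (c :: s1)).
- case: s1 => [|y s1] /=; last exact: prot_stack.
  by constructor; constructor.
Qed.

Lemma rotate_at_cat A B C :
  rotate_at (A ++ false :: true :: B ++ false :: C) (size A) (size B) =
  A ++ true :: B ++ false :: false :: C.
Proof.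
rewrite /rotate_at take_size_cat // !drop_cat.
have -> : (size A).+2 < size A = false by lia.
have -> : (size A).+2 - size A = 2 by lia.
have -> : (size A + size B).+3 < size A = false by lia.
have -> : (size A + size B).+3 - size A = (size B).+3 by lia.
by rewrite /= drop0 take_size_cat // drop_cat ltnNge leqnSn /= subSnn /= drop0.
Qed.

Lemma rotbP s t : reflect
  (exists A B C, [/\ s = A ++ false :: true :: B ++ false :: C,
     balanced B & t = A ++ true :: B ++ false :: false :: C]) (rotb s t).
Proof.
apply: (iffP hasP) => [[i _ /hasP[k _ /andP[]]]|[A [B [C [-> bB ->]]]]].
  case/and5P=> lts /eqP si /eqP si1 /eqP sk bB /eqP->.
  have lti : i < size s by lia.
  have lti1 : i.+1 < size s by lia.
  pose B := take k (drop i.+2 s).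
  have eqs : s = take i s ++ false :: true :: B ++ false :: drop (i + k).+3 s.
    rewrite -{1}(cat_take_drop i s) (drop_nth true) // si.
    rewrite (drop_nth false) // si1 /B -{1}(cat_take_drop k (drop i.+2 s)).
    rewrite drop_drop (_ : k + i.+2 = (i + k).+2); last by lia.
    by rewrite (drop_nth true lts) sk.
  exists (take i s), B, (drop (i + k).+3 s); split=> //.
exists (size A).
  by rewrite mem_iota !size_cat /=; lia.
apply/hasP; exists (size B).
  by rewrite mem_iota !size_cat /= !size_cat /=; lia.
rewrite rotate_at_cat eqxx andbT; apply/and5P; split.
- by rewrite !size_cat /= !size_cat /=; lia.
- by rewrite nth_cat ltnn subnn.
- by rewrite nth_cat ltnNge leqnSn /= subSnn.
- rewrite nth_cat ifN; last by lia.
  rewrite (_ : (size A + size B).+2 - size A = (size B).+2); last by lia.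
  by rewrite /= nth_cat ltnn subnn.
- rewrite drop_cat ifN; last by lia.
  rewrite (_ : (size A).+2 - size A = 2); last by lia.
  by rewrite /= drop0 take_size_cat.
Qed.

Lemma brot_rotb t t' : brot t t' -> rotb (bword t) (bword t').
Proof.
move=> rt; apply/rotbP; elim: rt => {t t'} [a b c|l l' r _|l r r' _].
- exists (bword a ++ true :: bword b), (bword c), [::].
  by rewrite balancedE bword_dyck /= -?catA /= -?catA.
- case=> A [B [C [/= -> bB ->]]].
  exists A, B, (C ++ true :: bword r ++ [:: false]).
  by split=> //=; rewrite -?catA /= -?catA.
- case=> A [B [C [/= -> bB ->]]].
  exists (bword l ++ true :: A), B, (C ++ [:: false]).
  by split=> //=; rewrite -?catA /= -?catA /= -?catA.
Qed.

(* After [A D U B D] and [A U B D D] the parser is in states that differ by a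
   rotation of the current tree, and [prot] is preserved by reading [C]. *)
Lemma rotb_brot s s' :
  dyckw 0 s -> rotb s s' -> brot (word_tree s) (word_tree s').
Proof.
move=> ds /rotbP[A [B [C [es bB es']]]]; rewrite es in ds *; rewrite es'.
rewrite /word_tree; have := dyckw_foldl (Leaf, [::]) _ _ ds.
have := dyckw_foldl (Leaf, [::]) (A ++ false :: true :: B ++ false :: C) [::].
rewrite cats0 => /(_ ds).
rewrite !foldl_cat; case: (foldl _ _ A) => c [|l stk] //=.
rewrite !foldl_cat -[B]word_treeK -?balancedE // !foldl_bword /=.
have /(prot_foldl _ _ C) :
    prot (Node (Node l c) (word_tree B), stk)
         (Node l (Node c (word_tree B)), stk).
  by constructor; constructor.
by case=> [//|? [|? ?]].
Qed.

(** * The Tamari order *)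

Definition dtree n (x : dyck_path n) := word_tree (val (val x)).
Definition dend n (x : dyck_path n) := fend (dtree n x).
Arguments dtree {n}.
Arguments dend {n}.

Lemma dyckw_val n (x : dyck_path n) : dyckw 0 (val (val x)).
Proof. by rewrite -balancedE (valP x). Qed.

Lemma bword_dtree n (x : dyck_path n) : bword (dtree x) = val (val x).
Proof. exact/word_treeK/dyckw_val. Qed.

Lemma bsize_dtree n (x : dyck_path n) : bsize (dtree x) = n.
Proof.
by apply: double_inj; rewrite -size_bword bword_dtree size_tuple.
Qed.

Lemma dtree_inj n : injective (@dtree n).
Proof. by move=> x y eqt; do 2!apply: val_inj; rewrite -!bword_dtree eqt. Qed.

Lemma dtree_surj n t : bsize t = n -> exists x : dyck_path n, dtree x = t.
Proof.
move=> szt; have szw : size (bword t) == n.*2 by rewrite size_bword szt.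
have bw : balanced (Tuple szw) by rewrite balancedE /= bword_dyck.
by exists (Sub (Tuple szw) bw); rewrite /dtree SubK /= bwordK.
Qed.

Section DyckPosets.
Variable n : nat.
Implicit Types x y z b : dyck_path n.

Lemma dend_bracketing x : bracketing n (dend x).
Proof.
by rewrite -[n in bracketing n](bsize_dtree _ x); apply: fend_bracketing.
Qed.

Lemma dend_inj x y : (forall i, i < n -> dend x i = dend y i) -> x = y.
Proof.
by move=> eqxy; apply/dtree_inj/fend_inj; rewrite !bsize_dtree.
Qed.

Lemma bracketing_dend f : bracketing n f ->
  exists x, forall i, i < n -> dend x i = f i.
Proof.
case/bracketing_fend=> t szt ft; have [x dx] := dtree_surj _ _ szt.
by exists x; rewrite /dend dx.
Qed.

Lemma tam_rotP x y : reflect (brot (dtree x) (dtree y)) (tam_rot x y).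
Proof.
apply: (iffP idP) => [|/brot_rotb]; last by rewrite !bword_dtree.
exact/rotb_brot/dyckw_val.
Qed.

(** The trace on bracket vectors of the rotation at the valley between up-steps [m] and [m.+1]. *)
Definition raises x m z := exists k, [/\ k <= m, dend x k = m,
  forall j, j < k -> dend x j != m &
  forall i, i < n -> dend z i = if i == k then dend x m.+1 else dend x i].

Lemma raises_exists x m : m.+1 < n -> dend x m = m ->
  exists2 z, tam_rot x z & raises x m z.
Proof.
move=> ltmn xm; have exk : exists k, dend x k == m by exists m; rewrite xm.
case: (ex_minnP exk) => k /eqP xk mink.
have lekm : k <= m by apply: mink; rewrite xm.
have minkN j : j < k -> dend x j != m.
  by apply: contraL => /mink; rewrite -leqNgt.
have [|||t rt ft] := brot_raise (dtree x) k m _ _ xk; rewrite ?bsize_dtree //.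
  by lia.
have [|z dz] := dtree_surj n t.
  by rewrite -(brot_bsize _ _ rt) bsize_dtree.
exists z; first by apply/tam_rotP; rewrite dz.
by exists k; split=> // i ltin; rewrite /dend dz ft ?bsize_dtree.
Qed.

Definition dle x y := [forall i : 'I_n, dend x i <= dend y i].

Lemma dleP x y :
  reflect (forall i, i < n -> dend x i <= dend y i) (dle x y).
Proof.
apply: (iffP forallP) => [le_xy i ltin|le_xy i]; last exact: le_xy.
exact: (le_xy (Ordinal ltin)).
Qed.

Lemma dle_refl x : dle x x.
Proof. exact/dleP. Qed.

Lemma dle_trans x y z : dle x y -> dle y z -> dle x z.
Proof.
move=> /dleP xy /dleP yz; apply/dleP => i ltin.
by apply: leq_trans (yz i ltin); apply: xy.
Qed.

Lemma dle_anti x y : dle x y -> dle y x -> x = y.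
Proof.
move=> /dleP xy /dleP yx; apply: dend_inj => i ltin.
by apply/eqP; rewrite eqn_leq xy ?yx.
Qed.

Lemma raises_lt x m z : m.+1 < n -> raises x m z -> dle x z && (x != z).
Proof.
move=> ltmn [k [lekm xk _ zk]].
have := (dend_bracketing x).1 m.+1 ltmn => xm.
apply/andP; split.
  by apply/dleP => i ltin; rewrite zk //; case: eqP => // ->; lia.
by apply/eqP => eqxz; have := zk k; rewrite -eqxz eqxx; lia.
Qed.

(* The largest index where [x] and [y] differ decides which valley of [x] to
   rotate. *)
Lemma dle_raises x y : dle x y -> x != y ->
  exists m, [/\ m.+1 < n, dend x m = m &
    forall z, raises x m z -> dle z y].
Proof.
move=> /dleP le_xy neq_xy.
have [x1 x2] := dend_bracketing x; have [y1 y2] := dend_bracketing y.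
have exj : exists j, (j < n) && (dend x j < dend y j).
  case: (pickP (fun j : 'I_n => dend x j < dend y j)) => [j ltj|eq_xy].
    by exists j; rewrite ltn_ord.
  case/eqP: neq_xy; apply: dend_inj => i ltin; apply/eqP.
  by have := eq_xy (Ordinal ltin); have := le_xy i ltin => /=; lia.
have bdj j : (j < n) && (dend x j < dend y j) -> j <= n by lia.
case: (ex_maxnP exj bdj) => j /andP[ltjn ltj] maxj.
have xjj := x1 j ltjn; have yjj := y1 j ltjn.
exists (dend x j); split; first by lia.
  by have := x1 (dend x j); have := x2 j (dend x j) ltjn; lia.
move=> z [k [lekm xk mink zk]]; apply/dleP => i ltin; rewrite zk //.
case: eqP => [->|_]; last exact: le_xy.
have lekj : k <= j.
  by rewrite leqNgt; apply/negP => /mink; rewrite eqxx.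
have ykj : dend y j <= dend y k.
  by apply: y2; [lia|have := le_xy k; lia].
(* By maximality of [j] the vectors agree here, and in [y] this index lies inside the excursion of
   [j], itself inside that of [k]. *)
have : dend x (dend x j).+1 = dend y (dend x j).+1.
  have := maxj (dend x j).+1; have := le_xy (dend x j).+1; lia.
by move=> ->; have := y2 j (dend x j).+1; lia.
Qed.

(** Rotations raise vectors. Conversely [dle_raises] gives a rotation of [x] that stays below [y],
    and the interval up to [y] shrinks strictly. *)
Lemma tam_leE x y : tam_le x y = dle x y.
Proof.
apply/idP/idP => [/connectP[p]|].
  elim: p x => [|z p IH] x /= => [_ ->|/andP[/tam_rotP rxz pzp] eqy].
    exact: dle_refl.
  apply: dle_trans (IH _ pzp eqy); apply/dleP => i ltin.
  by apply: brot_fend => //; rewrite bsize_dtree.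
have [N] := ubnP #|[set w | dle x w && dle w y]|.
elim: N x => // N IH x leN le_xy.
have [->|neq_xy] := eqVneq x y; first exact: connect0.
have [m [ltmn xm le_zy]] := dle_raises _ _ le_xy neq_xy.
have [z rxz raz] := raises_exists _ _ ltmn xm.
have {le_zy} le_zy := le_zy _ raz.
have /andP[le_xz neq_xz] := raises_lt _ _ _ ltmn raz.
apply: connect_trans (connect1 rxz) (IH z _ le_zy).
rewrite ltnS in leN; apply: leq_trans leN; apply/proper_card/properP; split.
  apply/subsetP => w; rewrite !inE => /andP[zw ->].
  by rewrite (dle_trans _ _ _ le_xz zw).
exists x; rewrite !inE ?dle_refl ?le_xy //.
by apply: contra neq_xz => /andP[zx _]; rewrite (dle_anti _ _ le_xz zx).
Qed.

Lemma covbP y x : reflect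
  [/\ dle y x, y <> x & forall z, dle y z -> dle z x -> z = y \/ z = x]
  (covb (@tam_le n) y x).
Proof.
rewrite /covb /plt; apply: (iffP andP) => -[].
  move=> /andP[/eqP neq]; rewrite tam_leE => le /forallP nz; split=> // z yz zx.
  have := nz z; rewrite !tam_leE yz zx.
  have [->|_] := eqVneq y z; first by left.
  by have [->|_] := eqVneq z x; first by right.
move=> le neq nz; split; first by rewrite tam_leE le andbT; apply/eqP.
apply/forallP => z; rewrite !tam_leE; apply/negP.
move=> /andP[/andP[/eqP yz le1] /andP[/eqP zx le2]].
by case: (nz z) => // e; case: yz.
Qed.

(** The elements covering [b] are its rotations, one per valley; the last index is left out because
    no up-step follows it. *)
Lemma upcoversE b :
  #|upcovers (@tam_le n) b| = #|[set m : 'I_n.-1 | dend b m == m :> nat]|.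
Proof.
have [b1 b2] := dend_bracketing b.
have ltm (m : 'I_n.-1) : m.+1 < n by have := ltn_ord m; lia.
have /fin_all_exists[F FP] (m : 'I_n.-1) :
    exists z, dend b m = m -> raises b m z.
  case: (dend b m =P m :> nat) => [bm|]; last by exists b.
  by have [z _ rz] := raises_exists b m (ltm m) bm; exists z.
suff -> : upcovers (@tam_le n) b =
    F @: [set m : 'I_n.-1 | dend b m == m :> nat].
  apply: card_in_imset => m m'; rewrite !inE => /eqP/FP[k [lekm bk _ zk]].
  move=> /eqP/FP[k' [lekm' bk' _ zk']] eqF; apply: val_inj => /=.
  have lm := ltm m; have lm' := ltm m'.
  case: (k =P k') => [ekk|/eqP nekk]; first by rewrite -bk ekk.
  have := zk k; have := zk' k; rewrite eqF eqxx (negPf nekk).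
  by have := b1 m.+1 lm; lia.
apply/setP => z; rewrite inE; apply/covbP/imsetP => [[le_bz neq_bz btw]|].
  have [|m [ltmn bm le_z]] := dle_raises b z le_bz; first exact/eqP.
  have ltm' : m < n.-1 by lia.
  have rF := FP (Ordinal ltm') bm.
  exists (Ordinal ltm'); first by rewrite inE /= bm.
  have /andP[leF neqF] := raises_lt _ _ _ ltmn rF.
  case: (btw _ leF (le_z _ rF)) => // e.
  by rewrite e eqxx in neqF.
case=> m; rewrite inE => /eqP bm ->.
have rF := FP m bm; have /andP[leF /eqP neqF] := raises_lt _ _ _ (ltm m) rF.
split=> // w /dleP le_bw /dleP le_wF.
case: rF => k [lekm bk mink Fk]; have lm := ltm m.
have [w1 w2] := dend_bracketing w.
have eqw i : i < n -> i != k -> dend w i = dend b i.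
  move=> ltin ik; have := le_bw i ltin; have := le_wF i ltin.
  by rewrite Fk // (negPf ik); lia.
have ltkn : k < n by lia.
case: (dend w k =P dend b k) => [ewk|nwk]; [left|right];
  apply: dend_inj => i ltin.
  by have [->|] := eqVneq i k => //; apply: eqw.
rewrite Fk //; have [->|] := eqVneq i k; last exact: eqw.
(* Once entry [k] of [w] exceeds [m], the excursion contains [m.+1], and nesting pushes the entry up
   to [dend b m.+1]. *)
have := le_wF k ltkn; rewrite Fk // eqxx; have := le_bw k ltkn.
by have := w2 k m.+1 ltkn; rewrite (eqw m.+1); lia.
Qed.

End DyckPosets.

(** * The image of Pop *)

(* In the forest, [f (c) = f j] with [j < c] minimal says that [c] is the last
   child of [j]; this drops it, so that [j] now ends just before [c]. *)
Definition drop_last (f : nat -> nat) j :=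
  j + find (fun c => f c == f j) (iota j.+1 (f j - j)).

Lemma drop_last_leaf f j : f j = j -> drop_last f j = j.
Proof. by move=> fj; rewrite /drop_last fj subnn /= addn0. Qed.

Variant drop_last_spec (f : nat -> nat) j v : Prop :=
  DropLastSpec of j <= v & v < f j & f v.+1 = f j &
    (forall i, j < i <= v -> f i <= v).

(** The search succeeds because [f j] is its own end. An interval starting in [(j, v]] and passing
    [v] would contain [v.+1], hence end at [f j], and the search would have stopped there
    earlier. *)
Lemma drop_lastP n f j : bracketing n f -> j < n -> f j != j ->
  drop_last_spec f j (drop_last f j).
Proof.
move=> [f1 f2] ltjn nfj; rewrite /drop_last.
set s := iota _ _; set d := find _ _.
have fj := f1 j ltjn; have ffj : f (f j) = f j.
  by have := f1 (f j); have := f2 j (f j) ltjn; lia.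
have hs : has (fun c => f c == f j) s.
  by apply/hasP; exists (f j); [rewrite mem_iota; lia|apply/eqP].
have ltd : d < f j - j by move: hs; rewrite has_find size_iota.
have fd : f (j + d).+1 = f j.
  by have /eqP := nth_find 0 hs; rewrite nth_iota.
split=> // [||i /andP[ji ivd]]; [lia|lia|].
have lti : i - j.+1 < d by lia.
have := before_find 0 lti; rewrite nth_iota; last by lia.
rewrite (_ : j.+1 + (i - j.+1) = i); last by lia.
move=> nfi; have := f2 j i ltjn; have := f2 i (j + d).+1; rewrite fd.
move: nfi => /eqP; lia.
Qed.

Lemma drop_last_bounds n f j : bracketing n f -> j < n ->
  j <= drop_last f j <= f j.
Proof.
move=> brf ltjn; have [fj|/drop_lastP] := eqVneq (f j) j.
  by rewrite drop_last_leaf // fj leqnn.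
by case/(_ n brf ltjn) => jv vf _ _; rewrite jv ltnW.
Qed.

Lemma bracketing_drop_last n f : bracketing n f -> bracketing n (drop_last f).
Proof.
move=> brf; have [f1 f2] := brf; split=> [i|i j] ltin.
  by have := drop_last_bounds _ _ _ brf ltin; have := f1 i ltin; lia.
move=> lej; case: (ltngtP i j) => [ij|ij|-> //]; last by lia.
have [fi|nfi] := eqVneq (f i) i; first by rewrite drop_last_leaf in lej; lia.
have [iv vf _ fv] := drop_lastP _ _ _ brf ltin nfi.
have := fv j; have := f1 i ltin.
by have := drop_last_bounds _ _ j brf; lia.
Qed.

(** This produces the candidates for elements covered by a path: a single entry is lowered. *)
Lemma bracketing_lower n f j v : bracketing n f -> j < n -> j <= v <= f j ->
    (forall i, j < i <= v -> f i <= v) ->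
  bracketing n (fun i => if i == j then v else f i).
Proof.
move=> [f1 f2] ltjn jvf fv; have fj := f1 j ltjn; split=> [i|i k] ltin.
  by case: eqP => [->|_]; [lia|exact: f1].
case: (i =P j) => [->|nij]; case: (k =P j) => [->|nkj] //.
- by have := fv k; lia.
- by have := f2 i j ltin; lia.
- exact: f2.
Qed.

Section Pop.
Variable n : nat.
Implicit Types x y b : dyck_path n.

(** Let [k] be the largest index where [x] and [y] differ. Lowering only entry [k] of [x] to its
    [drop_last] value gives an element between [y] and [x], which must be [y]. *)
Lemma dend_le_cover x y j : covb (@tam_le n) y x -> j < n ->
  drop_last (dend x) j <= dend y j.
Proof.
case/covbP=> /dleP le_yx neq_yx btw ltjn.
have brx := dend_bracketing n x; have bry := dend_bracketing n y.
have [x1 x2] := brx; have [y1 y2] := bry.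
have exk : exists k, (k < n) && (dend y k < dend x k).
  case: (pickP (fun k : 'I_n => dend y k < dend x k)) => [k ltk|eq_yx].
    by exists k; rewrite ltn_ord.
  case: neq_yx; apply: dend_inj => i ltin; apply/eqP.
  by have := eq_yx (Ordinal ltin); have := le_yx i ltin => /=; lia.
have bdk k : (k < n) && (dend y k < dend x k) -> k <= n by lia.
case: (ex_maxnP exk bdk) => k /andP[ltkn ltk] maxk.
have yk := y1 k ltkn.
have nxk : dend x k != k by lia.
have eqxy i : k < i < n -> dend x i = dend y i.
  by move=> ki; have := maxk i; have := le_yx i; lia.
case: (drop_lastP _ _ _ brx ltkn nxk).
set v := drop_last _ k => kv vx xv xle.
(* Otherwise [v.+1] lies in the excursion of [k] in [y], and its entry, common to [x] and [y],
   equals [dend x k]. *)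
have yv : dend y k <= v.
  rewrite leqNgt; apply/negP => vy.
  by have := y2 k v.+1 ltkn; have := eqxy v.+1; lia.
have [|z dz] := bracketing_dend n (fun i => if i == k then v else dend x i).
  by apply: bracketing_lower => //; lia.
have zx : z <> x by move=> ezx; have := dz k ltkn; rewrite ezx eqxx; lia.
have le_yz : dle n y z.
  by apply/dleP => i ltin; rewrite dz //; case: eqP => [->|_] //; apply: le_yx.
have le_zx : dle n z x.
  by apply/dleP => i ltin; rewrite dz //; case: eqP => [->|_] //; apply: ltnW.
case: (btw z le_yz le_zx) => // <-; rewrite dz //.
case: eqP => [->|_] //.
by have := drop_last_bounds _ _ j brx ltjn; lia.
Qed.

Lemma drop_last_cover x y j : j < n -> dend x j != j ->
    (forall i, i < n ->
       dend y i = if i == j then drop_last (dend x) j else dend x i) ->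
  covb (@tam_le n) y x.
Proof.
move=> ltjn nxj dy; have brx := dend_bracketing n x.
case: (drop_lastP _ _ _ brx ltjn nxj) => jv vx xv xle.
apply/covbP; split=> [|eyx|w /dleP le_yw /dleP le_wx].
- by apply/dleP => i ltin; rewrite dy //; case: eqP => [->|_] //; apply: ltnW.
- by have := dy j ltjn; rewrite eyx eqxx; lia.
have eqw i : i < n -> i != j -> dend w i = dend x i.
  move=> ltin ij; have := le_yw i ltin; have := le_wx i ltin.
  by rewrite dy // (negPf ij); lia.
have [x1 x2] := brx; have [w1 w2] := dend_bracketing n w.
have le1 := le_yw j ltjn; have le2 := le_wx j ltjn.
rewrite dy // eqxx in le1.
case: (dend w j =P dend x j) => [ewj|nwj]; [right|left];
  apply: dend_inj => i ltin.
  by have [->|] := eqVneq i j => //; apply: eqw.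
rewrite dy //; have [->|] := eqVneq i j; last exact: eqw.
apply/eqP; rewrite eqn_leq le1 andbT leqNgt; apply/negP => ltv.
have xj := x1 j ltjn.
have := w2 j (drop_last (dend x) j).+1 ltjn.
by rewrite (eqw _.+1) ?xv; lia.
Qed.

(** Dropping all last children at once is the meet: no covered element goes below these values, and
    each inner entry attains its value at the covered element that lowers it alone. *)
Lemma pop_imageP b : reflect
  (exists x, forall i, i < n -> dend b i = drop_last (dend x) i)
  (b \in pop_image (@tam_le n)).
Proof.
have glb x p : (forall i, i < n -> dend p i = drop_last (dend x) i) ->
    is_glb (@tam_le n) (x |: [set y | covb (@tam_le n) y x]) p.
  move=> dp; have brx := dend_bracketing n x; apply/andP; split.
    apply/forall_inP => y; rewrite !inE tam_leE => /orP[/eqP->|cyx].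
      apply/dleP => i ltin; rewrite dp //.
      by case/andP: (drop_last_bounds _ _ i brx ltin).
    by apply/dleP => i ltin; rewrite dp //; apply: dend_le_cover.
  apply/forallP => l; apply/implyP => /forall_inP lel; rewrite tam_leE.
  apply/dleP => j ltjn; rewrite dp //.
  have [xj|nxj] := eqVneq (dend x j) j.
    have := lel x; rewrite tam_leE !inE eqxx => /(_ isT)/dleP/(_ j ltjn).
    by rewrite drop_last_leaf ?xj.
  case: (drop_lastP _ _ _ brx ltjn nxj) => jv vx xv xle.
  have [|z dz] := bracketing_dend n
      (fun i => if i == j then drop_last (dend x) j else dend x i).
    by apply: bracketing_lower => //; lia.
  have := lel z; rewrite !inE (drop_last_cover _ _ _ ltjn nxj dz) orbT tam_leE.
  by move=> /(_ isT)/dleP/(_ j ltjn); rewrite dz // eqxx.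
rewrite inE; apply: (iffP existsP) => -[x]; last by exists x; apply: glb.
case/andP=> /forall_inP lbb /forallP maxb; exists x.
have [p dp] := bracketing_dend n _
  (bracketing_drop_last _ _ (dend_bracketing n x)).
have /andP[/forall_inP lbp /forallP maxp] := glb x p dp.
suff -> : b = p by [].
apply: dle_anti; rewrite -tam_leE.
  by apply: (implyP (maxp b)); apply/forall_inP.
by apply: (implyP (maxb p)); apply/forall_inP.
Qed.

End Pop.

(** * Shape of the paths in the image of Pop *)

Definition pop_shape n (f : nat -> nat) := forall i, i < n -> f i != i ->
  (f i).+1 < n /\ (forall j, j < i -> f j != j -> f j != f i).

(** If [j < i] had the same new end, the old excursion of [i] would lie within the shortened one of
    [j], although the end of [i] has strictly dropped. *)
Lemma pop_shape_drop_last n f :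
  bracketing n f -> pop_shape n (drop_last f).
Proof.
move=> brf i ltin npi; have [f1 f2] := brf.
have nfi : f i != i by apply: contraNneq npi => fi; rewrite drop_last_leaf.
case: (drop_lastP _ _ _ brf ltin nfi) => iv vf fv fle.
have fi := f1 i ltin; split=> [|j ji npj]; first by lia.
have nfj : f j != j by apply: contraNneq npj => fj; rewrite drop_last_leaf.
have ltjn : j < n by lia.
case: (drop_lastP _ _ _ brf ltjn nfj) => jv vfj fvj flej.
by apply/eqP => epp; have := flej i; rewrite epp in flej *; lia.
Qed.

(* A right inverse of [drop_last]: an inner vertex [j] takes its next sibling
   [(f j).+1] as new last child; [k] is fuel. *)
Fixpoint regrow (f : nat -> nat) k j :=
  if k is k'.+1 then if f j == j then j else regrow f k' (f j).+1 else j.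

Lemma pop_shape_inv n f : bracketing n f -> pop_shape n f ->
  exists2 g, bracketing n g & forall i, i < n -> drop_last g i = f i.
Proof.
move=> [f1 f2] shf.
(* Each recursive call strictly increases the index, so any fuel of at least [n - j] gives the same
   value. *)
have regrowE k k' j : j < n -> n - j <= k -> n - j <= k' ->
    regrow f k j = regrow f k' j.
  elim: k k' j => [|k IH] [|k'] j ltjn lek lek' /=; try lia.
  case: ifPn => // nfj; have [lt_fj _] := shf j ltjn nfj.
  by have := f1 j ltjn => ?; apply: IH; lia.
pose g := regrow f n.
have g_leaf j : j < n -> f j = j -> g j = j.
  by move=> ltjn fj; rewrite /g; case: (n) ltjn => //= ? _; rewrite fj eqxx.
have g_node j : j < n -> f j != j -> g j = g (f j).+1.
  move=> ltjn nfj; have [lt_fj _] := shf j ltjn nfj.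
  by rewrite /g (regrowE n n.+1 j) //= ?(negPf nfj) //; lia.
have indn (P : nat -> Prop) : (forall j, j < n ->
    (forall i, j < i < n -> P i) -> P j) -> forall j, j < n -> P j.
  move=> IH j; have [N] := ubnP (n - j); elim: N j => // N IHN j leN ltjn.
  by apply: IH => // i ji; apply: IHN; lia.
have g1 : forall j, j < n -> j <= g j < n.
  apply: indn => j ltjn IH; have [fj|nfj] := eqVneq (f j) j.
    by rewrite g_leaf // leqnn.
  have [lt_fj _] := shf j ltjn nfj; rewrite g_node //.
  by have := IH (f j).+1; have := f1 j ltjn; lia.
(* Ends being distinct, an inner [i] inside the excursion of [j] ends before [f j], so its next
   sibling is still inside. *)
have g_in j : j < n -> forall i, i < n -> j < i <= f j -> g i <= f j.
  move=> ltjn; apply: indn => i ltin IH ji; have [fi|nfi] := eqVneq (f i) i.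
    by rewrite g_leaf //; lia.
  have [lt_fi nfij] := shf i ltin nfi; rewrite g_node //.
  have := f1 i ltin; have := f2 j i ltjn; have := nfij j.
  by have := IH (f i).+1; lia.
have brg : bracketing n g.
  suff g2 : forall i, i < n -> forall k, i <= k <= g i -> g k <= g i.
    by split=> // i k ltin; apply: g2.
  apply: indn => i ltin IH k.
  have [fi|nfi] := eqVneq (f i) i.
    by rewrite (g_leaf i) // -eqn_leq => /eqP <-; rewrite g_leaf.
  have [lt_fi _] := shf i ltin nfi; have := f1 i ltin => fi.
  case: (ltngtP i k) => [ik|ik|-> //]; last by lia.
  rewrite (g_node i) // => kg; case: (leqP k (f i)) => kfi.
    by have := g_in i ltin k; have := g1 (f i).+1; lia.
  by have := IH (f i).+1 _ k; lia.
exists g => // j ltjn; have [fj|nfj] := eqVneq (f j) j.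
  by rewrite fj drop_last_leaf // g_leaf.
have [lt_fj _] := shf j ltjn nfj; have fj := f1 j ltjn.
have gj := g_node j ltjn nfj; have gfj := g1 (f j).+1 lt_fj.
have ngj : g j != j by lia.
case: (drop_lastP _ _ _ brg ltjn ngj) => jv vg gv gle.
(* The dropped child starts right after [drop_last g j] and ends at [g j > f j]. Starting inside the
   old excursion contradicts [g_in]; starting later contradicts [gle] at [(f j).+1]. *)
case: (ltngtP (drop_last g j) (f j)) => // ltv.
  by have := g_in j ltjn (drop_last g j).+1; lia.
by have := gle (f j).+1; lia.
Qed.

Lemma pop_image_shape n (b : dyck_path n) :
  reflect (pop_shape n (dend b)) (b \in pop_image (@tam_le n)).
Proof.
apply: (iffP (pop_imageP n b)) => [[x db]|].
  move=> i ltin; have := pop_shape_drop_last _ _ (dend_bracketing n x) i ltin.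
  rewrite -db // => shx nbi; have [lt_bi shi] := shx nbi.
  split=> // j ji; have ltjn := ltn_trans ji ltin.
  by have := shi j ji; rewrite -db.
case/(pop_shape_inv _ _ (dend_bracketing n b)) => g brg dg.
have [x dx] := bracketing_dend n _ brg; exists x => i ltin.
rewrite -dg // /drop_last dx //; congr (_ + _).
apply: eq_in_find => c; rewrite mem_iota => cr; rewrite dx //.
by have := brg.1 i ltin; lia.
Qed.

(** * Motzkin paths *)

(** For [k.*2 <= m], the number of nonnegative paths from height 0 with [m - k] up-steps and [k]
    down-steps. *)
Definition ballot m k := 'C(m, k) - (if k is k'.+1 then 'C(m, k') else 0).

Lemma leq_binS m k : k.*2 < m -> 'C(m, k) <= 'C(m, k.+1).
Proof. by move=> ltkm; have := mul_bin_left m k; nia. Qed.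

Lemma ballotS m k : k.*2.+1 < m ->
  ballot m.+1 k.+1 = ballot m k.+1 + ballot m k.
Proof.
case: k => [|k] ltkm; rewrite /ballot.
  by rewrite !bin0 !bin1; lia.
rewrite 2!binS; have := leq_binS m k; have := leq_binS m k.+1; lia.
Qed.

(** Boundary case of the Pascal rule: the other summand vanishes by symmetry of the binomials. *)
Lemma ballot_diag k : ballot k.*2.+2 k.+1 = ballot k.*2.+1 k.
Proof.
rewrite /ballot binS; have sym : 'C(k.*2.+1, k.+1) = 'C(k.*2.+1, k).
  by rewrite -bin_sub; [congr 'C(_, _)|]; lia.
case: k sym => [|k] sym; first by rewrite bin0 bin1.
by rewrite sym [X in _ - X]binS; lia.
Qed.

Lemma ballot_mulSn k : ballot k.*2 k * k.+1 = 'C(k.*2, k).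
Proof.
case: k => // k; rewrite /ballot mulnBl; have := mul_bin_left k.+1.*2 k.
have -> : k.+1.*2 - k = k.+2 by lia.
by nia.
Qed.

Lemma ballot_catalan k : ballot k.*2 k = catalan k.
Proof. by rewrite /catalan -ballot_mulSn mulnK. Qed.

(* The letters [Some true], [None] and [Some false] are the up, flat and down
   steps of a Motzkin path. *)
Fixpoint motz_dyck (w : seq (option bool)) : seq bool :=
  match w with
  | [::] => [::]
  | Some true :: w' => true :: motz_dyck w'
  | None :: w' => [:: true, false & motz_dyck w']
  | Some false :: w' => [:: true, false, false & motz_dyck w']
  end.

Lemma motz_dyck_cat v w : motz_dyck (v ++ w) = motz_dyck v ++ motz_dyck w.
Proof. by elim: v => //= -[[]|] v /= ->. Qed.

(** No encoded word begins with a down-step, so the number of down-steps after the first up-step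
    identifies the first letter. *)
Lemma motz_dyck_inj : injective motz_dyck.
Proof.
have noD w s : motz_dyck w <> false :: s by case: w => [|[[]|] w].
elim=> [|[[]|] v IH] [|[[]|] w] //= [] e;
  try by [rewrite (IH _ e)|case: (noD _ _ e)].
all: by case: (noD _ _ (esym e)).
Qed.

Fixpoint motz_words n : seq (seq (option bool)) :=
  if n is n'.+1 then
    [seq c :: w | c <- [:: Some true; None; Some false], w <- motz_words n']
  else [:: [::]].

Lemma mem_motz_words n w : (w \in motz_words n) = (size w == n).
Proof.
elim: n w => [|n IH] [|c w] //.
  by apply/allpairsP => -[[? ?] /= [_ _]].
rewrite eqSS -IH; apply/allpairsP/idP => [[[d v] /= [_ vn [_ ->]]]|wn] //.
by exists (c, w); split=> //; case: c => [[]|].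
Qed.

Lemma motz_words_uniq n : uniq (motz_words n).
Proof.
elim: n => // n IH; apply: allpairs_uniq => // -[a b] [c d] _ _ /= [-> ->] //.
Qed.

(** The three factors change the height by 1, 0 and -1, so the Dyck condition says that [w] is a
    Motzkin path from height [h] down to 0. *)
Definition motz_pred h k w :=
  dyckw h (motz_dyck w) && (count_mem (Some true) w == k).

Definition motz_count n h k := count (motz_pred h k) (motz_words n).

Lemma motz_countS n h k : motz_count n.+1 h k =
  (if k is k'.+1 then motz_count n h.+1 k' else 0) +
  motz_count n h k + (if h is h'.+1 then motz_count n h' k else 0).
Proof.
rewrite /motz_count /= !count_cat !count_map addn0 addnA.
congr (_ + _ + _).
- case: k => [|k].
    by apply/eqP; rewrite -leqn0 leqNgt -has_count; apply/hasPn => w _ /=;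
      rewrite /motz_pred /= andbF.
  by apply: eq_count => w; rewrite /motz_pred /= add1n eqSS.
- case: h => [|h] /=.
    by apply/eqP; rewrite -leqn0 leqNgt -has_count; apply/hasPn.
  by apply: eq_count => w; rewrite /motz_pred /=.
Qed.

(** There are [k] up-steps and [k + h] down-steps: the binomial places them among the flat steps,
    and the ballot number orders them, read backwards from height 0 to [h]. *)
Lemma motz_countE n h k :
  motz_count n h k = 'C(n, k.*2 + h) * ballot (k.*2 + h) k.
Proof.
elim: n h k => [|n IH] h k.
  by rewrite bin0n; case: h k => [|h] [|k]; rewrite ?addnS.
rewrite motz_countS; case: k => [|k]; case: h => [|h].
- by rewrite !IH /= !bin0 /ballot !bin0.
- by rewrite !IH /ballot /= !bin0 !subn0 !muln1 !add0n binS.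
- rewrite !IH doubleS !addn0 addn1 ballot_diag -mulnDl binS.
  by rewrite addnC.
- rewrite !IH doubleS !addSn !addnS ballotS; last by lia.
  by rewrite binS mulnDl !mulnDr; lia.
Qed.

(** * Trees whose words avoid three consecutive down-steps *)

(* No three consecutive down-steps in [bword t]. *)
Fixpoint thin t :=
  if t is Node l r then
    [&& thin l, thin r & if r is Node _ (Node _ _) then false else true]
  else true.

Definition internal t := count (fun i => fend t i != i) (iota 0 (bsize t)).

Lemma internal_Node l r :
  internal (Node l r) = internal l + (0 < bsize r) + internal r.
Proof.
rewrite /internal [bsize _]/= -addnS iotaD count_cat add0n -addnA /=.
congr (_ + (_ + _)).
- by apply: eq_in_count => i; rewrite mem_iota add0n => /andP[_ il]; rewrite il.
- by rewrite ltnn eqxx; lia.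
- rewrite -(addn0 (bsize l).+1) iotaDl count_map; apply: eq_count => i /=.
  have -> : ((bsize l).+1 + i < bsize l) = false by lia.
  have -> : ((bsize l).+1 + i == bsize l) = false by lia.
  by rewrite addn0 addKn eqn_add2l.
Qed.

(** The last excursion is [U D], a flat step, or [U r U D D], which gives an up-step, the word of
    [r] and a down step. *)
Lemma thin_motz t : thin t -> exists w,
  [/\ bword t = motz_dyck w, size w = bsize t &
      count_mem (Some true) w = internal t].
Proof.
have [N] := ubnP (bsize t); elim: N t => // N IH [|l r] leN; first by exists [::].
case/and3P=> /= tl tr; case: r tr leN => [|r [|//]] /= tr leN _.
  have [|w [ww sw cw]] := IH l _ tl; first by move: leN; rewrite /=; lia.
  exists (rcons w None); rewrite -cats1 motz_dyck_cat size_cat count_cat ww sw cw.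
  by rewrite internal_Node /=; split=> //; rewrite ?addn1 ?addn0 //.
have [|w [ww sw cw]] := IH l _ tl; first by move: leN; rewrite /=; lia.
have [||v [vv sv cv]] := IH r; first by move: leN; rewrite /=; lia.
  by case/andP: tr.
exists (w ++ Some true :: v ++ [:: Some false]).
rewrite motz_dyck_cat /= motz_dyck_cat !size_cat /= !size_cat.
rewrite !count_cat /= !count_cat.
rewrite ww vv sw sv cw cv !internal_Node /=; split; first by rewrite -catA.
  by lia.
by rewrite (_ : internal Leaf = 0) //; lia.
Qed.

Lemma motz_thin t w : bword t = motz_dyck w -> thin t.
Proof.
have noDDD : ~~ infix [:: false; false; false] (motz_dyck w).
  by elim: w => [|[[]|] w] //=; case: w => [|[[]|] w] //=.
move=> eqw; move: noDDD; rewrite -eqw {w eqw}; apply: contraR.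
elim: t => [|l IHl r IHr] //=; rewrite !negb_and => /or3P[/IHl|/IHr|].
- case/infixP=> s1 [s2 ->]; apply/infixP.
  by exists s1, (s2 ++ true :: bword r ++ [:: false]); rewrite -!catA.
- case/infixP=> s1 [s2 ->]; apply/infixP.
  exists (bword l ++ true :: s1), (s2 ++ [:: false]).
  by rewrite -?catA /= -?catA.
- case: r {IHr} => [|a [|c d]] //= _; apply/infixP.
  exists (bword l ++ true :: bword a ++ true :: bword c ++ true :: bword d), [::].
  by rewrite -?catA /= -?catA /= -?catA /= -?catA /= -?catA.
Qed.

(** * Counting the image of Pop *)

(** Three down-steps right after an up-step close its own excursion and two inner ones with the same
    end. *)
Lemma thinP t : thin t <-> (forall i j, j < i < bsize t ->
  fend t i != i -> fend t j != j -> fend t j != fend t i).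
Proof.
elim: t => [|l IHl r IHr]; first by split=> // _ i j; rewrite ltn0 andbF.
have sN : bsize (Node l r) = (bsize l + bsize r).+1 by [].
split=> [/and3P[/IHl tl /IHr tr rb] i j /andP[ji lti]|dist].
- case: (ltngtP i (bsize l)) => il.
  + have jl := ltn_trans ji il; rewrite !fend_left //.
    by apply: tl; rewrite ji.
  + rewrite (fend_right l r i) //; set i' := i - _ => nfi.
    have lti' : i' < bsize r by lia.
    have nfi' : fend r i' != i' by lia.
    have fi' := fend_lt _ _ lti'; have gi' := fend_ge _ _ lti'.
    case: (ltngtP j (bsize l)) => jl.
    * by rewrite fend_left //; have := fend_lt _ _ jl; lia.
    * rewrite fend_right // => nfj.
      by have := tr i' (j - (bsize l).+1); lia.
    * rewrite jl fend_mid => _.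
      case: r rb {IHr tr sN lti nfi} @i' lti' nfi' fi' gi' => [//|a [|//]].
      move=> _ i' lti' nfi' fi' gi'.
      case: (ltngtP i' (bsize a)) => ia.
      - have fa := fend_lt _ _ ia.
        by rewrite fend_left //= in nfi' *; lia.
      - by move: lti' => /=; lia.
      - by rewrite ia fend_mid addn0 eqxx in nfi'.
  + rewrite il in ji *; rewrite fend_mid => _; rewrite fend_left // => _.
    by have := fend_lt _ _ ji; lia.
- apply/and3P; split.
  + apply/IHl => i j /andP[ji il]; have jl := ltn_trans ji il.
    by have := dist i j; rewrite !fend_left // ji sN; apply; lia.
  + apply/IHr => i j /andP[ji ir] nfi nfj.
    have := dist ((bsize l).+1 + i) ((bsize l).+1 + j).
    by rewrite !fend_right ?addKn; lia.
  + case: r {IHr} sN dist => [|a [|c d]] // sN dist.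
    (* The root and the root of its right subtree are both inner and end at the last index. *)
    have := dist ((bsize l).+1 + bsize a) (bsize l).
    rewrite fend_mid fend_right; last by lia.
    rewrite addKn fend_mid; move: sN => /= sN; lia.
Qed.

(** The root's excursion ends at the last index, so the root cannot be inner and its right subtree
    is empty. *)
Lemma pop_shape_thin t n : bsize t = n.+1 ->
  pop_shape n.+1 (fend t) <-> exists2 l, t = Node l Leaf & thin l.
Proof.
case: t => // l r szt; split=> [sht|[_ [<- er] tl]]; last subst r.
  have er : r = Leaf.
    case: r szt sht => // a b szt sht.
    have := sht (bsize l); rewrite fend_mid; move: szt => /= szt.
    by case; lia.
  subst r; exists l => //.
  have : thin (Node l Leaf).
    apply/thinP => i j /andP[ji lti] nfi nfj.
    by rewrite szt in lti; apply: (sht i lti nfi).2.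
  by rewrite /= andbT.
have dist : thin (Node l Leaf) by rewrite /= tl.
move=> i ltin nfi; split.
  move: nfi; case: (ltngtP i (bsize l)) => il.
  - by rewrite fend_left //; have := fend_lt _ _ il; rewrite /= addn0 in szt; lia.
  - by move: szt => /=; lia.
  - by rewrite il fend_mid addn0 eqxx.
by move=> j ji nfj; move/thinP: dist; apply; rewrite ?ji ?szt.
Qed.

Lemma internal_leaves t :
  count (fun i => fend t i == i) (iota 0 (bsize t)) + internal t = bsize t.
Proof. by rewrite count_predC size_iota. Qed.

Lemma mem_pop_image n (b : dyck_path n.+1) :
  b \in pop_image (@tam_le n.+1) <->
  exists2 l, dtree b = Node l Leaf & thin l.
Proof.
have := pop_shape_thin _ n (bsize_dtree _ b).
by split=> [/pop_image_shape/H|/H/pop_image_shape].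
Qed.

Lemma upcovers_pop_image n (b : dyck_path n.+1) :
  b \in pop_image (@tam_le n.+1) ->
  #|upcovers (@tam_le n.+1) b| = n - internal (dtree b).
Proof.
case/mem_pop_image => l tb _; have szl : bsize l = n.
  by have := bsize_dtree _ b; rewrite tb /=; lia.
rewrite upcoversE cardsE -sum1_card big_mkcond /=.
rewrite -(big_mkcond (fun m : 'I_n => dend b m == m :> nat)) /=.
rewrite -(big_mkord (fun m => dend b m == m) (fun=> 1)) sum1_count /index_iota subn0.
have -> : count (fun m => dend b m == m) (iota 0 n) =
          count (fun i => fend l i == i) (iota 0 n).
  apply: eq_in_count => i; rewrite mem_iota add0n -[X in _ < X]szl => /andP[_ il].
  by rewrite /dend tb fend_left.
have := internal_leaves l; rewrite tb internal_Node szl.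
by rewrite (_ : internal Leaf = 0) //=; lia.
Qed.

Lemma card_pop_image_internal n k :
  #|[set b in pop_image (@tam_le n.+1) | internal (dtree b) == k]| =
  'C(n, k.*2) * catalan k.
Proof.
rewrite -ballot_catalan -(addn0 k.*2) -motz_countE /motz_count -size_filter.
set S := [set b in _ | _]; set W := filter _ _.
(* The trailing flat letter is the final [U D] of a path in the image. *)
pose word_of w := motz_dyck (rcons w None).
rewrite cardE -(size_map (fun b : dyck_path n.+1 => val (val b)) (enum S)).
rewrite -(size_map word_of W); apply/perm_size/uniq_perm.
- rewrite map_inj_uniq ?enum_uniq //.
  by move=> x y exy; apply/val_inj/val_inj.
- rewrite map_inj_uniq ?filter_uniq ?motz_words_uniq // => v w.
  by move=> evw; apply: (@rcons_injl _ None); apply: motz_dyck_inj.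
move=> s; apply/mapP/mapP => [[b]|[w]].
  rewrite mem_enum inE => /andP[/mem_pop_image[l tb tl] /eqP kb] ->.
  have [w [ww sw cw]] := thin_motz _ tl.
  have szl : bsize l = n by have := bsize_dtree _ b; rewrite tb /=; lia.
  exists w; last by rewrite -bword_dtree tb /= ww /word_of -cats1 motz_dyck_cat.
  rewrite mem_filter mem_motz_words sw szl eqxx andbT /motz_pred -ww bword_dyck.
  by rewrite cw -kb tb internal_Node (_ : internal Leaf = 0) // !addn0 eqxx.
rewrite mem_filter mem_motz_words => /andP[/andP[dw /eqP cw] /eqP sw] ->.
have [l lw] : exists l, bword l = motz_dyck w.
  by exists (word_tree (motz_dyck w)); rewrite word_treeK.
have tl := motz_thin _ _ lw.
have [v [vv sv cv]] := thin_motz _ tl.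
have evw : v = w by apply: motz_dyck_inj; rewrite -vv.
have [|b tb] := dtree_surj n.+1 (Node l Leaf).
  by rewrite /= addn0 -sv evw sw.
exists b; last by rewrite -bword_dtree tb /= lw /word_of -cats1 motz_dyck_cat.
rewrite mem_enum inE; apply/andP; split; first by apply/mem_pop_image; exists l.
by rewrite tb internal_Node -cv evw cw (_ : internal Leaf = 0) // !addn0.
Qed.

(** The class of [b] is nonempty, so the factor ['C(n, k.*2)] in its cardinality is positive. *)
Lemma internal_le n (b : dyck_path n.+1) :
  b \in pop_image (@tam_le n.+1) -> internal (dtree b) <= n./2.
Proof.
move=> pb; set k := internal _.
have : 0 < #|[set b in pop_image (@tam_le n.+1) | internal (dtree b) == k]|.
  by apply/card_gt0P; exists b; rewrite inE pb /=.
rewrite card_pop_image_internal muln_gt0 bin_gt0 => /andP[le_kn _].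
lia.
Qed.

Lemma natr_catalan k : (k.+1%:R^-1 * 'C(k.*2, k)%:R = (catalan k)%:R :> rat)%R.
Proof.
rewrite -ballot_catalan -ballot_mulSn natrM mulrCA mulVf ?mulr1 //.
by rewrite Num.Theory.pnatr_eq0.
Qed.

Local Open Scope ring_scope.

Theorem theorem1p2 :
  (forall n : nat,
     map_poly (fun z : int => z%:~R : rat) (pop_poly (@tam_le n.+1)) =
     \sum_(k < (n./2).+1)
        ((k.+1)%:R^-1 * ('C(k.*2, k))%:R * ('C(n, k.*2))%:R) *: 'X^(n - k))
  /\
  (forall n : nat, (0 < n)%N ->
     #|pop_image (@tam_le n)| = motzkin n.-1).
Proof.
split=> [n|[//|n] _] /=.
  rewrite /pop_poly rmorph_sum /=.
  (* The image is split by number of inner vertices; [internal_le] ensures that [inord] does not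
     collapse classes. *)
  rewrite (partition_big
    (fun b => inord (internal (dtree b)) : 'I_(n./2).+1) xpredT) //=.
  apply: eq_bigr => k _; rewrite natr_catalan -natrM mulnC -card_pop_image_internal.
  rewrite scaler_nat -sumr_const; apply: eq_big => [b|b].
    rewrite inE; apply: andb_id2l => pb.
    by rewrite -val_eqE /= inordK // ltnS internal_le.
  move=> /andP[pb /eqP kb]; rewrite rmorphXn /= map_polyX upcovers_pop_image //.
  by rewrite -kb inordK // ltnS internal_le.
rewrite /motzkin -sum1_card.
rewrite (partition_big (fun b => inord (internal (dtree b)) : 'I_n.+1) xpredT) //=.
apply: eq_bigr => k _; rewrite -card_pop_image_internal -sum1_card.
apply: eq_bigl => b; rewrite inE; apply: andb_id2l => pb.
rewrite -val_eqE /= inordK // ltnS; have := internal_le _ _ pb; lia.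
Qed.
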